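(* Let $p$ be a prime, let $R := \mathbf{Z}/p^{k} \mathbf{Z}$ for some $k \geq 1$, and let $A \subset R$ be a non-empty finite set such that $|A+A| \leq K|A|$ and $|A \cdot A| \leq K|A|$ for some $K \geq 1$. Then one of the following holds: (i) $A \subset p \cdot R + \mathbf{O}( K^{O(1)} )$; (ii) $|A| \gg K^{-O(1)} |R|$.
   Context: For subsets $A,B$ of a ring: $A+B := \{a+b : a\in A, b\in B\}$, $A\cdot B := \{ab : a\in A, b\in B\}$; $p\cdot R := \{pr : r\in R\}$. $|A|$ denotes the cardinality of a finite set $A$. $X \gg Y$ means $Y \leq CX$ for some absolute constant $C$; $O(1)$ denotes a quantity bounded by an absolute constant. $\mathbf{O}(N)$ denotes an unspecified finite non-empty subset of $R$ of cardinality $O(N)$; thus (i) means that there is a finite non-empty set $X \subset R$ with $|X| \leq C K^{C}$, $C$ an absolute constant, such that $A \subset p\cdot R + X$. All implied constants are absolute (independent of $p$, $k$, $A$, $K$). *)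

(* Defs.v *)
From mathcomp Require Import all_boot all_order all_algebra.

Set Implicit Arguments.
Unset Strict Implicit.
Unset Printing Implicit Defensive.

Import GRing.Theory.
Local Open Scope ring_scope.

Section SumProductSets.
Variable R : finNzRingType.
Implicit Types A B : {set R}.

Definition sumset A B : {set R} := [set a + b | a in A, b in B].

Definition prodset A B : {set R} := [set a * b | a in A, b in B].

Definition natdilate (n : nat) A : {set R} := [set n%:R * a | a in A].

End SumProductSets.

(* Main.v *)
Require Import Defs.
From mathcomp Require Import all_boot all_order all_algebra.
From mathcomp Require Import reals exp.
From mathcomp Require Import ring.

Set Implicit Arguments.
Unset Strict Implicit.
Unset Printing Implicit Defensive.

Import Order.TTheory GRing.Theory Num.Theory.
Local Open Scope ring_scope.

(* Suppose that A meets w classes modulo N = pR with w larger than a power of K.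
   As |A + A| is at least w times the size of any fibre A :&: (t + N), no fibre
   carries more than a proportion K / w of A; in particular one may assume that
   A consists of units. By Cauchy-Schwarz for the multiplicative energy and the
   covering lemma, there are a large D inside a dilate of A and few translates
   of A - A that cover d A, for every d in D. If |D + x D| is much smaller than
   w |D|, then the map (a, c) |-> a + x c has a collision with c - d a unit,
   whence x = (a - b) / (c - d). Multiplying A + (x + 1) A by c - d embeds it
   into c A - d A + a A - b A + c A - d A, which is small by Pluennecke's
   inequality, with a bound that does not depend on x. So the smallness of
   D + x D propagates from x to x + 1, and holds for every x in R. Averaging the
   number of collisions over all x then forces D to be a large part of R. *)

(** * Cauchy-Schwarz for fibre sizes *)

Section CauchySchwarz.
Variables T U : finType.

Lemma sqr_sum_le (V : {set U}) (n : U -> nat) :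
  ((\sum_(u in V) n u) ^ 2 <= #|V| * \sum_(u in V) n u ^ 2)%N.
Proof.
rewrite -(leq_pmul2l (ltn0Sn 1)).
have -> : ((\sum_(u in V) n u) ^ 2 = \sum_(u in V) \sum_(v in V) n u * n v)%N.
  by rewrite expnS expn1 big_distrlr.
rewrite big_distrr /=.
apply: (@leq_trans (\sum_(u in V) \sum_(v in V) (n u ^ 2 + n v ^ 2))%N).
  apply: leq_sum => u _; rewrite big_distrr /=; apply: leq_sum => v _.
  exact: nat_Cauchy.
under eq_bigr do rewrite big_split /= sum_nat_const.
by rewrite big_split /= sum_nat_const -big_distrr /= mul2n addnn.
Qed.

(** The fibre sizes of [f] on [W] add up to [#|W|] and their squares to the number of colliding
    pairs; Cauchy-Schwarz over the image compares the two. *)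
Lemma card_sqr_le_collisions (f : T -> U) (W : {set T}) :
  (#|W| ^ 2 <= #|f @: W| *
     #|[set w : T * T | [&& w.1 \in W, w.2 \in W & f w.1 == f w.2]]|)%N.
Proof.
have cW : #|W| = (\sum_(u in f @: W) #|[set w in W | f w == u]|)%N.
  rewrite -sum1_card (partition_big_imset f) /=; apply: eq_bigr => u _.
  by rewrite -sum1_card; apply: eq_bigl => w; rewrite inE.
rewrite {1}cW; apply: leq_trans (sqr_sum_le _ _) _; rewrite leq_mul2l.
apply/orP; right.
rewrite -[X in (_ <= X)%N]sum1_card (partition_big (fun w => f w.1) (mem (f @: W))) /=; last first.
  by move=> [w w']; rewrite inE => /and3P[+ _ _]; apply: imset_f.
apply: leq_sum => u _; rewrite sum1dep_card expnS expn1 -cardsX.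
apply: subset_leq_card; apply/subsetP => -[w w']; rewrite !inE /=.
by move=> /andP[/andP[-> /eqP->] /andP[-> /eqP->]]; rewrite eqxx.
Qed.
End CauchySchwarz.

Lemma sum_card_fibres_le (T U : finType) (f : T -> U) (W : {set T}) (V : {set U}) :
  (\sum_(u in V) #|[set w in W | f w == u]| <= #|W|)%N.
Proof.
rewrite -[leqRHS]sum1_card (bigID (fun w => f w \in V)) /=.
rewrite (partition_big f (mem V)) /=; last by move=> w /andP[].
apply: leq_trans (leq_addr _ _); apply: leq_sum => u uV.
rewrite sum1dep_card; apply: subset_leq_card; apply/subsetP => w.
by rewrite !inE => /andP[-> /eqP->]; rewrite uV eqxx.
Qed.

(** * Sumsets: Ruzsa's covering lemma and Pluennecke's inequality *)

Section Sumsets.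
Variable R : finNzRingType.
Implicit Types (A B C H S V X Y Z : {set R}).

Definition diffset A : {set R} := [set a - b | a in A, b in A].

Definition nsumset n A : {set R} := iter n (sumset A) [set 0].

Definition separated V S : Prop :=
  forall s t, s \in S -> t \in S -> s - t \in V -> s = t.

Lemma mem_sumset A B a b : a \in A -> b \in B -> a + b \in sumset A B.
Proof. exact: imset2_f. Qed.

Lemma mem_diffset A a b : a \in A -> b \in A -> a - b \in diffset A.
Proof. exact: imset2_f. Qed.

Lemma sumsetC A B : sumset A B = sumset B A.
Proof.
by apply/setP => x; apply/imset2P/imset2P => -[a b Aa Bb ->]; exists b a; rewrite // addrC.
Qed.

Lemma sumsetA A B C : sumset A (sumset B C) = sumset (sumset A B) C.
Proof.
apply/setP => x; apply/imset2P/imset2P.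
  by move=> [a _ Aa /imset2P[b c Bb Cc ->] ->]; exists (a + b) c; rewrite ?mem_sumset ?addrA.
by move=> [_ c /imset2P[a b Aa Bb ->] Cc ->]; exists a (b + c); rewrite ?mem_sumset ?addrA.
Qed.

Lemma sumset0 A : sumset A [set 0] = A.
Proof.
apply/setP => x; apply/imset2P/idP => [[a b Aa /set1P-> ->]|Ax]; first by rewrite addr0.
by exists x 0; rewrite ?set11 ?addr0.
Qed.

Lemma sumsetSS A B C Z : A \subset B -> C \subset Z -> sumset A C \subset sumset B Z.
Proof. exact: imset2S. Qed.

Lemma card_sumset_le A B : (#|sumset A B| <= #|A| * #|B|)%N.
Proof. by rewrite -cardsX /sumset curry_imset2X leq_imset_card. Qed.

(** Addition is injective on [S] times [Z]: if [s + y = t + z], then [s - t = z - y] lies in [V], so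
    [s = t]. *)
Lemma card_separated_sumset V S Z : separated V S ->
    {in Z &, forall y z, y - z \in V} -> (#|S| * #|Z| <= #|sumset S Z|)%N.
Proof.
move=> sepS ZV; rewrite -cardsX /sumset curry_imset2X card_in_imset //.
move=> [s y] [t z] /setXP[/= Ss Zy] /setXP[/= St Zz] eq_st.
have st : s = t.
  apply: sepS => //; have -> : s - t = z - y; last exact: ZV.
  by apply/eqP; rewrite subr_eq addrAC -subr_eq opprK eq_st addrC.
by rewrite st in eq_st *; move/addrI: eq_st => ->.
Qed.

(** A maximal separated subset of [B] works: a point of [B] outside [V + S] could be added to it. *)
Lemma separated_net V B : 0 \in V -> (forall x, x \in V -> - x \in V) ->
  exists S, [/\ S \subset B, separated V S & B \subset sumset V S].
Proof.
move=> V0 VN.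
pose P S := (S \subset B) && [forall s in S, forall t in S, (s - t \in V) ==> (s == t)].
have P0 : P set0 by rewrite /P sub0set; apply/forall_inP => s; rewrite inE.
have [S /maxsetP[/andP[SB /forall_inP sepS] maxS] _] := maxset_exists P0.
have sep : separated V S.
  by move=> s t Ss St stV; apply/eqP; move/forall_inP/(_ t St)/implyP: (sepS s Ss); apply.
exists S; split=> //; apply/subsetP => b Bb; apply/negPn/negP => bVS.
have far s : s \in S -> b - s \notin V.
  by move=> Ss; apply: contra bVS => bsV; rewrite -[b](subrK s) mem_sumset.
have Sb : b \notin S by apply/negP => /far; rewrite subrr V0.
case/negP: Sb; rewrite -(maxS (b |: S)) ?setU11 ?subsetUr //.
rewrite /P subUset sub1set Bb SB /=; apply/forall_inP => s /setU1P[->|Ss].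
  apply/forall_inP => t /setU1P[->|St]; first by rewrite eqxx implybT.
  by rewrite (negPf (far t St)).
apply/forall_inP => t /setU1P[->|St]; last by apply/implyP => /(sep _ _ Ss St)->.
by apply/implyP => /VN; rewrite opprB (negPf (far s Ss)).
Qed.

(** For a net [S] that is separated with respect to [Z - Z], the translates [s + Z] are disjoint and
    lie in [B + Z]. *)
Lemma ruzsa_covering B Z : Z != set0 ->
  exists S, (#|S| * #|Z| <= #|sumset B Z|)%N /\ B \subset sumset (diffset Z) S.
Proof.
case/set0Pn => z Zz.
have V0 : 0 \in diffset Z by rewrite -(subrr z) mem_diffset.
have VN x : x \in diffset Z -> - x \in diffset Z.
  by case/imset2P=> a b Za Zb ->; rewrite opprB mem_diffset.
have [S [SB sepS BS]] := separated_net B V0 VN.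
exists S; split=> //; apply: leq_trans (subset_leq_card (sumsetSS SB (subxx Z))).
by apply: card_separated_sumset sepS _ => y y' Zy Zy'; apply: mem_diffset.
Qed.

(* By induction on C: adding c to C, the points x of X with x + c + A already in
   X + A + C' can be discounted on both sides, by minimality of X. *)
Lemma petridis A X C :
    (forall Z, Z \subset X -> #|sumset X A| * #|Z| <= #|sumset Z A| * #|X|)%N ->
  (#|sumset (sumset X A) C| * #|X| <= #|sumset X A| * #|sumset X C|)%N.
Proof.
move=> minX; have [n] := ubnP #|C|; elim: n C => // n IHn C.
have [->|[c Cc]] := set_0Vmem C.
  move=> _; suff -> : sumset (sumset X A) set0 = set0 by rewrite cards0.
  by apply/setP => x; rewrite inE; apply/imset2P => -[a b _]; rewrite inE.
rewrite (cardsD1 c) Cc ltnS => /IHn; set C' := C :\ c => IH.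
set S1 := sumset (sumset X A) C' in IH; set S2 := sumset X C' in IH.
pose Xc := [set x in X | [forall a in A, x + a + c \in S1]].
have XcX : Xc \subset X by apply/subsetP => x; rewrite inE => /andP[].
have XcA : sumset Xc A \subset sumset X A by apply: sumsetSS.
(* The new sums are of the form [y + c] with [y] in [X + A]; those with [y] in [Xc + A] already lie
   in [S1]. *)
have upper : (#|sumset (sumset X A) C| <= #|S1| + (#|sumset X A| - #|sumset Xc A|))%N.
  have -> : (#|sumset X A| - #|sumset Xc A|)%N =
      #|(+%R^~ c) @: (sumset X A :\: sumset Xc A)|.
    by rewrite (card_imset _ (@addIr _ c)) cardsD (setIidPr XcA).
  apply: leq_trans (leq_card_setU _ _); apply: subset_leq_card.
  apply/subsetP => _ /imset2P[y c' Xy Cc' ->]; rewrite inE.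
  have [->|nc] := eqVneq c' c; last first.
    by rewrite [_ \in S1]mem_sumset //= in_setD1 nc.
  rewrite -implyNb; apply/implyP => nS1; apply: (imset_f (+%R^~ c)); rewrite inE Xy andbT.
  apply: contra nS1 => /imset2P[x a]; rewrite inE => /andP[_ /forall_inP Xx] Aa ->.
  exact: Xx.
(* For [x] outside [Xc] the point [x + c] is new: [x + c = x' + c'] would put
   [x + a + c = x' + a + c'] in [S1] for all [a]. *)
have lower : (#|S2| + (#|X| - #|Xc|) <= #|sumset X C|)%N.
  have -> : (#|X| - #|Xc|)%N = #|(+%R^~ c) @: (X :\: Xc)|.
    by rewrite (card_imset _ (@addIr _ c)) cardsD (setIidPr XcX).
  rewrite -cardsUI [X in (_ + X)%N]eq_card0 ?addn0; last first.
    move=> y; rewrite !inE; apply/negP => /andP[S2y /imsetP[x /setDP[Xx nXc] yE]].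
    case/negP: nXc; rewrite inE Xx; apply/forall_inP => a Aa.
    move: S2y; rewrite yE => /imset2P[x' c' Xx' Cc' xc].
    by rewrite addrAC xc addrAC !mem_sumset.
  apply: subset_leq_card; rewrite subUset; apply/andP; split.
    by apply: sumsetSS => //; apply: subsetDl.
  by apply/subsetP => _ /imsetP[x /setDP[Xx _] ->]; rewrite mem_sumset.
have := minX _ XcX; have := subset_leq_card XcX; have := subset_leq_card XcA.
move: IH upper lower; move: #|sumset _ C| #|sumset X C| #|S1| #|S2|.
move: #|sumset X A| #|sumset Xc A| #|X| #|Xc|.
move=> k kc x xc a b s1 s2 IH up low le1 le2 le3.
apply: (@leq_trans (s1 * x + (k - kc) * x)%N); first by rewrite -mulnDl leq_mul2r up orbT.
apply: (@leq_trans (k * s2 + k * (x - xc))%N); last by rewrite -mulnDr leq_mul2l low orbT.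
(* Minimality at [Xc] says [k * xc <= kc * x]. *)
by rewrite leq_add // mulnBl mulnBr leq_sub2l.
Qed.

(** Choose [X] minimising [|X + A| / |X|]. As [A] itself competes, the minimum is at most [L], and
    [petridis] applies. *)
Lemma plunnecke_minimizer A L : A != set0 -> (#|sumset A A| <= L * #|A|)%N ->
  exists2 X, X != set0 /\ X \subset A &
    forall C, (#|sumset (sumset X A) C| <= L * #|sumset X C|)%N.
Proof.
move=> An0 AA.
pose P X := (X != set0) && (X \subset A).
have PA : P A by rewrite /P An0 subxx.
case: (arg_minP (fun X => #|sumset X A|%:R / #|X|%:R : rat) PA) => X /andP[Xn0 XA] minX.
have X0 : (0 < #|X|)%N by rewrite card_gt0.
have {}minX Z : P Z -> (#|sumset X A| * #|Z| <= #|sumset Z A| * #|X|)%N.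
  move=> PZ; move: (minX Z PZ); rewrite ler_pdivrMr ?ltr0n // mulrAC.
  rewrite ler_pdivlMr; last by rewrite ltr0n card_gt0; case/andP: PZ.
  by rewrite -!natrM ler_nat.
exists X => // C; rewrite -(leq_pmul2r X0).
apply: leq_trans (petridis C _) _ => [Z ZX|].
  have [->|Zn0] := eqVneq Z set0; first by rewrite cards0 muln0.
  by apply: minX; rewrite /P Zn0 (subset_trans ZX XA).
have A0 : (0 < #|A|)%N by rewrite card_gt0.
have ratio : (#|sumset X A| <= L * #|X|)%N.
  rewrite -(leq_pmul2r A0); apply: leq_trans (minX _ PA) _.
  by rewrite mulnAC leq_mul2r AA orbT.
by rewrite mulnAC leq_mul2r ratio orbT.
Qed.

(** For [h = u - v], the pairs [(x + u, x + v)] with [x] in [X] give [#|X|] points of [(X + B)^2]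
    with difference [h]. *)
Lemma ruzsa_triangle X B H :
    (forall h, h \in H -> exists u v, [/\ u \in B, v \in B & h = u - v]) ->
  (#|H| * #|X| <= #|sumset X B| ^ 2)%N.
Proof.
move=> HB; rewrite -mulnn -(cardsX (sumset X B)).
apply: leq_trans _ (sum_card_fibres_le (fun w : R * R => w.1 - w.2) _ H).
rewrite -sum_nat_const; apply: leq_sum => h /HB[u [v [Bu Bv ->]]].
rewrite -(@card_imset _ _ (fun x => (x + u, x + v)) (mem X)); last by move=> x y [/addIr].
apply: subset_leq_card; apply/subsetP => _ /imsetP[x Xx ->].
by rewrite !inE !mem_sumset //= opprD addrACA subrr add0r.
Qed.

Lemma iter_diffset A n h : h \in nsumset n (diffset A) ->
  exists u v, [/\ u \in nsumset n A,
                  v \in nsumset n A & h = u - v].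
Proof.
elim: n h => [|n IHn] h /=; first by move/set1P->; exists 0, 0; rewrite set11 subrr.
case/imset2P=> _ h' /imset2P[a b Aa Ab ->] /IHn[u [v [nu nv ->]]] ->.
exists (a + u), (b + v); rewrite !mem_sumset //; split=> //.
by rewrite opprD addrACA.
Qed.

(** Iterating the growth bound of the minimiser gives [|X + nA| <= L^n |X|]; the triangle inequality
    passes to [nA - nA], and [|X| <= |A|] concludes. *)
Lemma plunnecke A L n : A != set0 -> (#|sumset A A| <= L * #|A|)%N ->
  (#|nsumset n (diffset A)| <= L ^ n.*2 * #|A|)%N.
Proof.
move=> An0 AA; have [X [Xn0 XA] growth] := plunnecke_minimizer An0 AA.
have X0 : (0 < #|X|)%N by rewrite card_gt0.
have XnA : (#|sumset X (nsumset n A)| <= L ^ n * #|X|)%N.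
  elim: n => [|n IHn] /=; first by rewrite sumset0 mul1n.
  rewrite sumsetA; apply: leq_trans (growth _) _.
  by rewrite expnS -mulnA leq_mul2l IHn orbT.
rewrite -(leq_pmul2r X0); apply: leq_trans (ruzsa_triangle X (@iter_diffset A n)) _.
apply: (@leq_trans ((L ^ n * #|X|) ^ 2)); first by rewrite leq_exp2r.
rewrite expnMn -expnM muln2 -mulnA leq_mul2l expnS expn1 leq_mul2r.
by rewrite subset_leq_card ?orbT.
Qed.

End Sumsets.

(** * Sets covered by few translates of [nA - nA] *)

Section Covered.
Variable R : finNzRingType.
Implicit Types (A S T U : {set R}).

(** This form is stable under sums, where [m] multiplies and [n] adds, and under negation; a sum of
    several dilates then needs Pluennecke's inequality only once. *)
Definition covered A m n T : Prop :=
  exists2 S : {set R}, (#|S| <= m)%N & T \subset sumset (nsumset n (diffset A)) S.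

Lemma nsumsetD A m n : nsumset (m + n) A = sumset (nsumset m A) (nsumset n A).
Proof.
elim: m => [|m IHm]; first by rewrite sumsetC sumset0.
by rewrite addSn {1}/nsumset /= -/(nsumset _ _) IHm sumsetA.
Qed.

Lemma covered_sumset A m n m' n' T U :
  covered A m n T -> covered A m' n' U -> covered A (m * m') (n + n') (sumset T U).
Proof.
move=> [S mS TS] [S' mS' US']; exists (sumset S S').
  by apply: leq_trans (card_sumset_le _ _) _; apply: leq_mul.
rewrite nsumsetD -sumsetA [sumset (nsumset n' _) _]sumsetA.
rewrite [sumset (nsumset n' _) S]sumsetC -(sumsetA S) sumsetA.
exact: sumsetSS.
Qed.

Lemma nsumset_diffsetN A n x :
  x \in nsumset n (diffset A) -> - x \in nsumset n (diffset A).
Proof.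
elim: n x => [|n IHn] x /=; first by move/set1P->; rewrite oppr0 set11.
case/imset2P=> _ h /imset2P[a b Aa Ab ->] nh ->.
by rewrite opprD opprB mem_sumset ?mem_diffset ?IHn.
Qed.

Lemma covered_opp A m n T : covered A m n T -> covered A m n [set - t | t in T].
Proof.
move=> [S mS TS]; exists [set - s | s in S]; first by rewrite (leq_trans (leq_imset_card _ _)).
apply/subsetP => _ /imsetP[t /(subsetP TS)/imset2P[h s nh Ss ->] ->].
by rewrite opprD mem_sumset ?nsumset_diffsetN ?imset_f.
Qed.

Lemma card_covered A L m n T : A != set0 -> (#|sumset A A| <= L * #|A|)%N ->
  covered A m n T -> (#|T| <= m * L ^ n.*2 * #|A|)%N.
Proof.
move=> An0 AA [S mS TS]; apply: leq_trans (subset_leq_card TS) _.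
apply: leq_trans (card_sumset_le _ _) _; rewrite mulnC -mulnA.
exact: leq_mul (plunnecke _ An0 AA).
Qed.

End Covered.

(** * Dilates, multiplicative energy and collisions *)

Section Dilates.
Variable R : finComUnitRingType.
(* The cast makes the finType of R the one that [sumset] infers; otherwise the
   cardinals in the statements below match only up to conversion. *)
Local Notation Rset := {set (R : finNzRingType)}.
Implicit Types (A D N S Y : Rset) (x : R).

Definition dilate x A : Rset := [set x * a | a in A].

Lemma card_dilate x A : x \is a GRing.unit -> #|dilate x A| = #|A|.
Proof. by move=> ux; apply: card_imset; apply: mulrI. Qed.

(** Ruzsa covering of [dA] by [Z = A :&: dA]: here [dA + Z] lies in [d(A + A)], of size at most
    [L|A|], and [|Z|] is at least [|A| / 2L]. *)
Lemma covered_dilate A L d : A != set0 -> (#|sumset A A| <= L * #|A|)%N ->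
    d \is a GRing.unit ->
    (#|A| <= 2 * L * #|A :&: dilate d A|)%N ->
  covered A (2 * L ^ 2) 1 (dilate d A).
Proof.
move=> An0 AA ud popd; set Z := A :&: dilate d A in popd *.
have A0 : (0 < #|A|)%N by rewrite card_gt0.
have Z0 : Z != set0 by rewrite -card_gt0; case: posnP popd => // ->; rewrite muln0 leqNgt A0.
have [S [SZ AS]] := ruzsa_covering (dilate d A) Z0.
have {}SZ : (#|S| * #|Z| <= L * #|A|)%N.
  apply: leq_trans SZ _; rewrite -(card_dilate A ud) in AA *.
  have dAA : sumset (dilate d A) (dilate d A) = dilate d (sumset A A).
    apply/setP => x; apply/imset2P/imsetP.
      move=> [_ _ /imsetP[a Aa ->] /imsetP[b Ab ->] ->].
      by exists (a + b); rewrite ?mem_sumset ?mulrDr.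
    move=> [_ /imset2P[a b Aa Ab ->] ->]; exists (d * a) (d * b); rewrite ?mulrDr //.
      exact: imset_f.
    exact: imset_f.
  apply: leq_trans (subset_leq_card (sumsetSS (subxx _) (subsetIr A _))) _.
  by rewrite dAA card_dilate.
exists S; last first.
  apply: subset_trans AS _; rewrite /nsumset /= sumset0; apply: sumsetSS => //.
  by apply: imset2S; apply: subsetIl.
rewrite -(leq_pmul2r A0); apply: (@leq_trans (2 * L * (#|S| * #|Z|))).
  by rewrite mulnCA leq_mul2l popd orbT.
by apply: leq_trans (leq_mul (leqnn _) SZ) _; rewrite expnS expn1 !mulnA.
Qed.

Lemma card_sumset_dilate_succ A D L m x a b c d :
    A != set0 -> (#|sumset A A| <= L * #|A|)%N ->
    {in D, forall e, covered A m 1 (dilate e A)} ->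
    a \in D -> b \in D -> c \in D -> d \in D ->
    c - d \is a GRing.unit -> x * (c - d) = a - b ->
  (#|sumset A (dilate (x + 1)%R A)| <= m ^ 6 * L ^ 12 * #|A|)%N.
Proof.
move=> An0 AA covD Da Db Dc Dd ucd xE.
have cN e : e \in D -> covered A m 1 [set - t | t in dilate e A].
  by move=> De; apply: covered_opp (covD e De).
have cB e f : e \in D -> f \in D ->
    covered A (m * m) (1 + 1) (sumset (dilate e A) [set - t | t in dilate f A]).
  by move=> De Df; apply: covered_sumset (covD e De) (cN f Df).
(* Six dilates enter, each in [m] translates of [A - A]: hence [m ^ 6] translates of [6A - 6A], and
   the factor [L ^ 12]. *)
have := covered_sumset (covered_sumset (cB c d Dc Dd) (cB a b Da Db)) (cB c d Dc Dd).
move/(card_covered An0 AA); rewrite -(card_dilate (sumset A _) ucd).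
have -> : (m * m * (m * m) * (m * m) = m ^ 6)%N by rewrite !expnS expn0; ring.
apply: leq_trans; apply: subset_leq_card.
apply/subsetP => _ /imsetP[_ /imset2P[s _ As /imsetP[t At ->] ->] ->].
have -> : (c - d) * (s + (x + 1) * t) =
    (c * s - d * s) + (a * t - b * t) + (c * t - d * t).
  by rewrite -!mulrBl -xE; ring.
by rewrite !mem_sumset // ?imset_f // imset_f // imset_f.
Qed.

(** The multiplicative energy of [A] is at least [|A|^3 / L]. Fixing a good denominator [b], [D]
    collects the ratios [a / b] that are popular, that is, whose [r a b] is at least [|A| / 2L]. *)
Lemma popular_dilates A L : A != set0 -> {in A, forall a, a \is a GRing.unit} ->
    (#|prodset A A| <= L * #|A|)%N ->
  exists D, exists2 b, b \is a GRing.unit /\ dilate b D \subset A &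
    [/\ (#|A| <= 2 * L * #|D|)%N,
        {in D, forall d, d \is a GRing.unit} &
        {in D, forall d, #|A| <= 2 * L * #|A :&: dilate d A|}%N].
Proof.
move=> An0 unitA AA; have A0 : (0 < #|A|)%N by rewrite card_gt0.
pose r a b := #|A :&: dilate (a / b) A|.
pose E := [set w : (R * R) * (R * R) |
  [&& w.1 \in setX A A, w.2 \in setX A A & w.1.1 * w.1.2 == w.2.1 * w.2.2]].
have lowE : (#|A| ^ 3 <= L * #|E|)%N.
  have := card_sqr_le_collisions (fun w : R * R => w.1 * w.2) (setX A A).
  have -> : (fun w : R * R => w.1 * w.2) @: setX A A = prodset A A.
    apply/setP => u; apply/imsetP/imset2P => [[[a b] /setXP[Aa Ab] ->]|[a b Aa Ab ->]].
      by exists a b.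
    by exists (a, b); rewrite ?inE ?Aa.
  rewrite -/E cardsX => le1.
  rewrite -(leq_pmul2l A0) mulnCA mulnA.
  apply: (@leq_trans (#|prodset A A| * #|E|)); last by rewrite leq_mul2r AA orbT.
  by apply: leq_trans le1; rewrite -expnS expnMn -expnD.
(* In [a s = b t] with [a] and [b] fixed, [t] determines [s] since [a] is a unit, and [t] lies in
   [A] and in [(a / b) A]. *)
have upE : (#|E| <= \sum_(b in A) \sum_(a in A) r a b)%N.
  rewrite pair_big_dep /= -[leqLHS]sum1_card.
  rewrite (partition_big (fun w => (w.2.1, w.1.1))
    (fun u => (u.1 \in A) && (u.2 \in A))) /=; last first.
    by move=> [[a s] [b t]]; rewrite !inE /= => /and3P[/andP[-> _] /andP[-> _] _].
  apply: leq_sum => -[b a] /andP[/= Ab Aa]; rewrite sum1dep_card.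
  have [ua ub] := (unitA a Aa, unitA b Ab).
  set F := (X in #|X|).
  rewrite -(@card_in_imset _ _ (fun w => w.2.2) F); last first.
    move=> [[a1 s1] [b1 t1]] [[a2 s2] [b2 t2]]; rewrite !inE /=.
    move=> /andP[/and3P[_ _ /eqP e1] /eqP[? ?]] /andP[/and3P[_ _ /eqP e2] /eqP[? ?]] tt; subst.
    by rewrite -e2 in e1; move/(mulrI ua): e1 => ->.
  apply: subset_leq_card; apply/subsetP => _ /imsetP[[[a1 s] [b1 t]] + ->].
  rewrite !inE /= => /andP[/and3P[/andP[_ As] /andP[_ At] /eqP e] /eqP[eb ea]].
  rewrite At; apply/imsetP; exists s => //; rewrite eb ea in e.
  by rewrite mulrAC e mulrAC mulrV ?mul1r.
have [b Ab popb] : exists2 b, b \in A & (#|A| ^ 2 <= L * \sum_(a in A) r a b)%N.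
  case: (boolP [exists b in A, #|A| ^ 2 <= L * \sum_(a in A) r a b]%N) => [/exists_inP//|].
  rewrite negb_exists_in => /forall_inP small.
  (* If every [b] failed, each strict inequality would gain 1, and the total gain [#|A|] would
     contradict [lowE]. *)
  have : (L * #|E| + #|A| <= #|A| ^ 3)%N.
    apply: (@leq_trans (\sum_(b in A) (L * \sum_(a in A) r a b + 1))%N).
      by rewrite big_split /= sum1_card leq_add2r -big_distrr leq_mul2l upE orbT.
    rewrite expnS -sum_nat_const; apply: leq_sum => b Ab.
    by rewrite addn1 ltnNge small.
  by move/leq_trans/(_ lowE); rewrite leqNgt -addn1 leq_add2l A0.
have ub := unitA b Ab.
pose D0 := [set a in A | (#|A| <= 2 * L * r a b)%N].
exists [set a / b | a in D0], b.
  split=> //; apply/subsetP => _ /imsetP[_ /imsetP[a + ->] ->].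
  by rewrite inE mulrC divrK // => /andP[].
split; first last.
- by move=> _ /imsetP[a + ->]; rewrite inE => /andP[].
- move=> _ /imsetP[a + ->]; rewrite inE => /andP[/unitA ua _].
  by rewrite unitrM ua unitrV.
rewrite card_imset; last by apply: mulIr; rewrite unitrV.
have D0A : D0 \subset A by apply/subsetP => a; rewrite inE => /andP[].
(* Popular [a] contribute at most [2L|A|] each, the others less than [|A|] each; the left side is at
   least [2|A|^2]. *)
have : (2 * L * \sum_(a in A) r a b <= 2 * L * #|D0| * #|A| + #|A| * #|A|)%N.
  rewrite (big_setID D0) /= (setIidPr D0A) mulnDr leq_add //.
    rewrite -[leqRHS]mulnA leq_mul2l -sum_nat_const leq_sum ?orbT // => a _.
    by rewrite subset_leq_card ?subsetIl.
  rewrite big_distrr /= -sum_nat_const.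
  apply: (@leq_trans (\sum_(a in A :\: D0) #|A|)%N).
    apply: leq_sum => a /setDP[Aa]; rewrite inE Aa -ltnNge; exact: ltnW.
  by rewrite !sum_nat_const leq_mul2r subset_leq_card ?subsetDl ?orbT.
move=> up; rewrite -(leq_pmul2r A0) -(leq_add2r (#|A| * #|A|)).
by apply: leq_trans up; rewrite -mulnA mulnn addnn -mul2n leq_mul2l popb.
Qed.

Lemma dilate_collision D Y x : Y \subset D ->
    (#|sumset D (dilate x D)| < #|D| * #|Y|)%N ->
  exists a b c d, [/\ a \in D, b \in D, c \in Y, d \in Y & c != d /\ x * (c - d) = a - b].
Proof.
move=> YD; rewrite -cardsX ltnNge => small.
pose f (w : R * R) := w.1 + x * w.2.
have : ~~ dinjectiveb f (mem (setX D Y)).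
  apply: contra small => /dinjectiveP injf; rewrite -(card_in_imset injf).
  apply: subset_leq_card; apply/subsetP => _ /imsetP[[a c] /setXP[Da Yc] ->].
  by apply: mem_sumset => //; apply: imset_f; apply: (subsetP YD).
case/dinjectivePn=> -[b c] /setXP[/= Db Yc] [[a d]] /andP[/= ne /setXP[/= Da Yd] eqf].
exists a, b, c, d; split=> //; split.
  by apply: contraNneq ne => cd; move: eqf; rewrite /f /= cd => /addIr ->.
rewrite mulrBr; apply/eqP; rewrite subr_eq addrAC eq_sym subr_eq [x * c + b]addrC.
by move: eqf; rewrite /f /= => ->.
Qed.

(** By Cauchy-Schwarz every [x] has many collisions in [D] times [Y], whereas a collision with
    [c != d] determines [x] as its slope. Summing over [x] bounds the size of the ring. *)
Lemma card_ring_le D Y B : (0 < B)%N -> Y \subset D -> (2 * B <= #|Y|)%N ->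
    {in Y &, forall c d, c != d -> c - d \is a GRing.unit} ->
    (forall x, #|sumset D (dilate x D)| <= B * #|D|)%N ->
  (#|[set: (R : finNzRingType)]| <= 2 * B * #|D|)%N.
Proof.
move=> B0 YD BY unitY small.
pose W := setX D Y.
pose off := [set w : (R * R) * (R * R) | [&& w.1 \in W, w.2 \in W & w.1.2 != w.2.2]].
pose f x (w : R * R) := w.1 + x * w.2.
pose slope (w : (R * R) * (R * R)) := (w.2.1 - w.1.1) / (w.1.2 - w.2.2).
have Y0 : (0 < #|Y|)%N by apply: leq_trans BY; rewrite muln_gt0.
have D0 : (0 < #|D|)%N by apply: leq_trans (subset_leq_card YD).
have bound x : (#|D| * #|Y| ^ 2 <= B * (#|D| * #|Y| + #|[set w in off | slope w == x]|))%N.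
  have := card_sqr_le_collisions (f x) W.
  set E := (X in (_ * #|X|)%N) => le1.
  have le2 : (#|f x @: W| <= B * #|D|)%N.
    apply: leq_trans (small x); apply: subset_leq_card.
    apply/subsetP => _ /imsetP[[a c] /setXP[Da Yc] ->].
    by apply: mem_sumset => //; apply: imset_f; apply: (subsetP YD).
  (* A collision with [c = d] is diagonal; any other has slope [x]. *)
  have le3 : (#|E| <= #|D| * #|Y| + #|[set w in off | slope w == x]|)%N.
    rewrite -cardsX -/W -(@card_imset _ _ (fun w => (w, w)) (mem W)); last by move=> ? ? [].
    apply: leq_trans (leq_card_setU _ _); apply: subset_leq_card.
    apply/subsetP => -[[a c] [b d]]; rewrite inE /= => /and3P[Wac Wbd /eqP]; rewrite /f /= => eqf.
    rewrite inE; have [cd|ncd] := eqVneq c d.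
      by move: eqf; rewrite cd => /addIr ->; rewrite imset_f.
    apply/orP; right; rewrite !inE /= -!in_setX Wac Wbd ncd /=.
    have [/setXP[_ Yc] /setXP[_ Yd]] := (Wac, Wbd).
    have ucd := unitY c d Yc Yd ncd.
    rewrite -(inj_eq (mulIr ucd)) /slope /= divrK //.
    by rewrite mulrBr subr_eq addrAC eq_sym subr_eq [x * c + a]addrC eqf addrC.
  rewrite -(leq_pmul2l D0); apply: (@leq_trans (#|W| ^ 2)).
    by rewrite cardsX expnMn !expnS !expn0 !muln1 !mulnA.
  apply: leq_trans le1 _; rewrite mulnA [(#|D| * B)%N]mulnC.
  exact: leq_mul.
have : (\sum_(x in [set: (R : finNzRingType)]) (#|D| * #|Y| ^ 2) <=
    \sum_(x in [set: (R : finNzRingType)]) B * (#|D| * #|Y| + #|[set w in off | slope w == x]|))%N.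
  by apply: leq_sum => x _; apply: bound.
rewrite sum_nat_const -big_distrr big_split /= sum_nat_const.
have := sum_card_fibres_le slope off [set: (R : finNzRingType)].
have : (#|off| <= (#|D| * #|Y|) ^ 2)%N.
  rewrite -cardsX -/W -mulnn -cardsX; apply: subset_leq_card.
  by apply/subsetP => -[u v]; rewrite inE /= => /and3P[Wu Wv _]; rewrite in_setX Wu.
move: (\sum_(x in _) _)%N BY D0 Y0 => s; move: #|off| #|D| #|Y| #|[set: (R : finNzRingType)]| => o d y q.
move=> By d0 y0 le1 le2 le3.
have dyy : (0 < d * y ^ 2)%N by rewrite muln_gt0 d0 expn_gt0 y0.
(* After doubling, the diagonal term [2 * B * (q * d * y)] is absorbed by one copy of
   [q * d * y ^ 2], because [2 * B <= y]. *)
rewrite -(leq_pmul2r dyy) -(leq_add2r (q * (d * y ^ 2))).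
apply: (@leq_trans (2 * (B * (q * (d * y) + (d * y) ^ 2)))).
  rewrite addnn -mul2n leq_mul2l /=; apply: leq_trans le3 _.
  by rewrite leq_mul2l leq_add2l (leq_trans le2) ?orbT.
have -> : (2 * (B * (q * (d * y) + (d * y) ^ 2)) =
  2 * B * d * (d * y ^ 2) + 2 * B * (q * d * y))%N by ring.
rewrite leq_add2l; have -> : (q * (d * y ^ 2) = y * (q * d * y))%N by ring.
by rewrite leq_mul2r By orbT.
Qed.
End Dilates.

(** * The sum-product estimate in a finite local ring *)

Section LocalRing.
Variable R : finComUnitRingType.
Local Notation Rset := {set (R : finNzRingType)}.
Implicit Types (A D N S X Y : Rset) (x : R).

Lemma card_sumset_dilate_mono A D b x : b \is a GRing.unit -> dilate b D \subset A ->
  (#|sumset D (dilate x D)| <= #|sumset A (dilate x A)|)%N.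
Proof.
move=> ub DA; rewrite -(card_dilate (sumset D _) ub); apply: subset_leq_card.
apply/subsetP => _ /imsetP[_ /imset2P[s _ Ds /imsetP[t Dt ->] ->] ->].
rewrite mulrDr mulrCA; apply: mem_sumset; first by apply: (subsetP DA); apply: imset_f.
by apply/imset_f/(subsetP DA)/imset_f.
Qed.

Lemma card_le_fibres D N Y m : D \subset sumset N Y ->
    {in Y, forall y, #|[set d in D | (d - y)%R \in N]| <= m}%N ->
  (#|D| <= #|Y| * m)%N.
Proof.
move=> DNY small.
have sub : D \subset \bigcup_(y in Y) [set d in D | (d - y)%R \in N].
  apply/subsetP => d Dd; have /imset2P[n y Nn Yy dE] := subsetP DNY d Dd.
  by apply/bigcupP; exists y; rewrite // inE Dd dE addrK.
apply: leq_trans (subset_leq_card sub) _; rewrite -sum_nat_const.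
apply: (@leq_trans (\sum_(y in Y) #|[set d in D | (d - y)%R \in N]|)%N); last exact: leq_sum.
elim/big_ind2: _ => [|S m1 T m2 le1 le2|//]; first by rewrite cards0.
by apply: leq_trans (leq_card_setU _ _) _; apply: leq_add.
Qed.

(** [N] stands for the maximal ideal and [w] for the number of classes met by [A]. Representatives
    [Y] of [D] modulo [N] number at least [w / 2L^2]; either they are few and [w] is bounded, or
    they leave room for collisions. *)
Lemma sum_product_units A N L w : A != set0 -> {in A, forall a, a \is a GRing.unit} ->
    (#|sumset A A| <= L * #|A|)%N -> (#|prodset A A| <= L * #|A|)%N ->
    0 \in N -> {in N &, forall x y, x - y \in N} ->
    (forall r x, x \in N -> r * x \in N) ->
    (forall x, x \notin N -> x \is a GRing.unit) ->
    (forall x, exists n, x = n%:R) ->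
    (forall t, #|[set a in A | (a - t)%R \in N]| * w <= L * #|A|)%N ->
  (w <= 512 * L ^ 27)%N \/ (#|[set: (R : finNzRingType)]| <= 256 * L ^ 25 * #|A|)%N.
Proof.
move=> An0 unitA AA AM N0 NB NM unitN genR fibre.
have A0 : (0 < #|A|)%N by rewrite card_gt0.
have [D [b [ub DA] [AD unitD popD]]] := popular_dilates An0 unitA AM.
have DleA : (#|D| <= #|A|)%N by rewrite -(card_dilate D ub) subset_leq_card.
have L0 : (0 < L)%N by case: posnP AD => // ->; rewrite muln0 mul0n leqNgt A0.
have D0 : (0 < #|D|)%N by case: posnP AD => // ->; rewrite muln0 leqNgt A0.
have NN x : x \in N -> - x \in N by move=> Nx; rewrite -sub0r NB.
have [Y [YD sepY DY]] := separated_net D N0 NN.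
have unitY : {in Y &, forall c d, c != d -> c - d \is a GRing.unit}.
  move=> c d Yc Yd ncd; apply: unitN; apply: contra ncd => Ncd.
  by rewrite (sepY c d).
have wY : (w <= 2 * L ^ 2 * #|Y|)%N.
  have [->//|w0] := posnP w.
  have fib : {in Y, forall y, #|[set d in D | (d - y)%R \in N]| <= L * #|A| %/ w}%N.
    move=> y _; rewrite leq_divRL //; apply: leq_trans (fibre (b * y)).
    rewrite leq_mul2r; apply/orP; right; rewrite -(card_dilate _ ub).
    apply: subset_leq_card; apply/subsetP => _ /imsetP[d + ->].
    rewrite !inE => /andP[Dd Ndy]; rewrite -mulrBr NM // andbT.
    by apply: (subsetP DA); apply: imset_f.
  rewrite -(leq_pmul2l D0); apply: (@leq_trans (#|Y| * (L * #|A| %/ w) * w)).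
    by rewrite leq_mul2r (card_le_fibres DY fib) orbT.
  rewrite -mulnA; apply: (@leq_trans (#|Y| * (L * (2 * L * #|D|)))); last first.
    by apply: eq_leq; rewrite expnS expn1; ring.
  rewrite leq_mul2l; apply/orP; right; apply: leq_trans (leq_divM _ _) _.
  by rewrite leq_mul2l AD orbT.
have [Ysmall|Ylarge] := leqP #|Y| (256 * L ^ 25).
  left; apply: leq_trans wY _; apply: (@leq_trans (2 * L ^ 2 * (256 * L ^ 25))).
    by rewrite leq_mul2l Ysmall orbT.
  by rewrite mulnACA -expnD.
(* [B] is [(2 * L ^ 2) ^ 6 * L ^ 12] from the six dilates, times [2 * L] from [|A| <= 2L|D|]. *)
right; set B := (128 * L ^ 25)%N.
have B0 : (0 < B)%N by rewrite muln_gt0 expn_gt0 L0.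
have BY : (2 * B < #|Y|)%N by rewrite /B mulnA.
have small x : (#|sumset D (dilate x D)| <= B * #|D|)%N.
  (* The hypothesis at [n] only serves to produce a collision; the bound at [n + 1] is then derived
     afresh from [A], so no loss accumulates. *)
  have [n ->] := genR x; elim: n => [|n IHn].
    apply: leq_trans (card_sumset_le _ _) _; rewrite mulnC leq_mul2r.
    apply/orP; right; apply: leq_trans B0; rewrite -(cards1 (0 : (R : finNzRingType))).
    by apply: subset_leq_card; apply/subsetP => _ /imsetP[d _ ->]; rewrite mul0r set11.
  have col : (#|sumset D (dilate n%:R D)| < #|D| * #|Y|)%N.
    apply: leq_ltn_trans IHn _; rewrite mulnC ltn_mul2l D0.
    by apply: leq_ltn_trans BY; rewrite leq_pmull.
  have [a [a' [c [d [Da Da' Yc Yd [ncd slope]]]]]] := dilate_collision YD col.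
  have covD : {in D, forall e, covered A (2 * L ^ 2) 1 (dilate e A)}.
    by move=> e De; apply: covered_dilate (unitD e De) (popD e De).
  have YinD := subsetP YD.
  have := card_sumset_dilate_succ An0 AA covD Da Da' (YinD c Yc) (YinD d Yd)
    (unitY c d Yc Yd ncd) slope.
  rewrite -natr1; move/(leq_trans (card_sumset_dilate_mono _ ub DA))/leq_trans; apply.
  apply: (@leq_trans ((2 * L ^ 2) ^ 6 * L ^ 12 * (2 * L * #|D|))).
    by rewrite leq_mul2l AD orbT.
  by apply: eq_leq; rewrite /B; ring.
apply: leq_trans (card_ring_le B0 YD (ltnW BY) unitY small) _.
by rewrite /B mulnA leq_mul2l DleA orbT.
Qed.

(** [X] represents the classes of [A] modulo [N]. If it is large, the non-units of [A], which lie in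
    the fibre over 0, are at most half of [A]; passing to the units turns [L] into [2 * L]. *)
Lemma sum_product_local A N L : A != set0 ->
    (#|sumset A A| <= L * #|A|)%N -> (#|prodset A A| <= L * #|A|)%N ->
    0 \in N -> {in N &, forall x y, x - y \in N} ->
    (forall r x, x \in N -> r * x \in N) ->
    (forall x, x \notin N -> x \is a GRing.unit) ->
    (forall x, exists n, x = n%:R) ->
  (exists X, [/\ X != set0, (#|X| <= 512 * (2 * L) ^ 27)%N & A \subset sumset N X])
  \/ (#|[set: (R : finNzRingType)]| <= 256 * (2 * L) ^ 25 * #|A|)%N.
Proof.
move=> An0 AA AM N0 NB NM unitN genR.
have A0 : (0 < #|A|)%N by rewrite card_gt0.
have NN x : x \in N -> - x \in N by move=> Nx; rewrite -sub0r NB.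
have [X [XA sepX AX]] := separated_net A N0 NN.
have X0 : X != set0.
  apply: contraNneq An0 => X0; rewrite -subset0; apply: subset_trans AX _.
  by apply/subsetP => y /imset2P[n x _ + _]; rewrite X0 inE.
have L0 : (0 < L)%N.
  rewrite lt0n; apply/eqP => L0; move: AA; rewrite L0 mul0n leqn0 cards_eq0 => /eqP AA0.
  by case/set0Pn: An0 => a Aa; have := mem_sumset Aa Aa; rewrite AA0 inE.
have [Xsmall|Xlarge] := leqP #|X| (512 * (2 * L) ^ 27); first by left; exists X.
right.
have fibre t : (#|[set a in A | (a - t)%R \in N]| * #|X| <= L * #|A|)%N.
  apply: leq_trans AA; rewrite mulnC; set Z := [set a in A | _].
  have ZN : {in Z &, forall y z, y - z \in N}.
    move=> y z; rewrite !inE => /andP[_ Ny] /andP[_ Nz].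
    have -> : y - z = (y - t) - (z - t) by rewrite opprB addrA subrK.
    exact: NB.
  apply: leq_trans (card_separated_sumset sepX ZN) (subset_leq_card _).
  by apply: sumsetSS => //; apply/subsetP => z; rewrite inE => /andP[].
pose U := [set a in A | a \is a GRing.unit].
have UA : U \subset A by apply/subsetP => a; rewrite inE => /andP[].
have AU : (#|A| <= 2 * #|U|)%N.
  have nonunits : (#|A :\: U| * (2 * L) <= L * #|A|)%N.
    apply: leq_trans (fibre 0); apply: leq_mul.
      apply: subset_leq_card; apply/subsetP => a /setDP[Aa].
      by rewrite !inE Aa subr0; apply: contraNT => /unitN.
    apply: leq_trans (ltnW Xlarge); apply: (@leq_trans ((2 * L) ^ 27)).
      by rewrite -[X in (X <= _)%N]expn1 leq_pexp2l ?muln_gt0.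
    by rewrite leq_pmull.
  rewrite -(leq_add2r (2 * #|A :\: U|)) -mulnDr -{2}(setIidPr UA) cardsID.
  rewrite [X in (_ <= X)%N]mul2n -addnn leq_add2l.
  by rewrite -(leq_pmul2l L0) mulnCA mulnA mulnC.
have U0 : U != set0 by rewrite -card_gt0; case: posnP AU => // ->; rewrite leqNgt A0.
have bound m : (m <= L * #|A| -> m <= 2 * L * #|U|)%N.
  by move/leq_trans; apply; rewrite mulnAC [leqRHS]mulnC leq_mul2l AU orbT.
have UU : (#|sumset U U| <= 2 * L * #|U|)%N.
  by apply/bound/(leq_trans _ AA)/subset_leq_card/sumsetSS.
have UM : (#|prodset U U| <= 2 * L * #|U|)%N.
  by apply/bound/(leq_trans _ AM)/subset_leq_card/imset2S.
have unitU : {in U, forall a, a \is a GRing.unit} by move=> a; rewrite inE => /andP[].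
have fibreU t : (#|[set a in U | (a - t)%R \in N]| * #|X| <= 2 * L * #|U|)%N.
  apply/bound/(leq_trans _ (fibre t)); rewrite leq_mul2r subset_leq_card ?orbT //.
  by apply/subsetP => a; rewrite !inE => /andP[/andP[-> _] ->].
have [|le] := sum_product_units U0 unitU UU UM N0 NB NM unitN genR fibreU.
  by rewrite leqNgt Xlarge.
by apply: leq_trans le _; rewrite leq_mul2l subset_leq_card ?orbT.
Qed.

End LocalRing.

(** * Specialisation to Z/p^k and real constants *)

Lemma natdilate_Zpk_unit (p k : nat) (x : 'Z_(p ^ k)) : prime p -> (1 <= k)%N ->
  x \notin natdilate p [set: 'Z_(p ^ k)] -> x \is a GRing.unit.
Proof.
(* ['Z_n] is Z/nZ only for [n > 1], hence [n1]; its units are then the residues prime to [p]. *)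
move=> p_pr k0 Nx; have n1 : (1 < p ^ k)%N by rewrite -(exp1n k) ltn_exp2r ?prime_gt1.
rewrite -[x]natr_Zp unitZpE // coprime_pexpl // prime_coprime //.
apply: contra Nx => /dvdnP[m xE]; apply/imsetP.
by exists m%:R; rewrite ?inE // -[x]natr_Zp xE natrM mulrC.
Qed.

Theorem theorem5p6 (F : realType) :
  exists C : F, 0 < C /\
  forall (p k : nat) (A : {set 'Z_(p ^ k)}) (K : F),
    prime p -> (1 <= k)%N -> A != set0 -> 1 <= K ->
    #|sumset A A|%:R <= K * #|A|%:R ->
    #|prodset A A|%:R <= K * #|A|%:R ->
    (exists X : {set 'Z_(p ^ k)},
       [/\ X != set0,
           #|X|%:R <= C * powR K C
         & A \subset sumset (natdilate p [set: 'Z_(p ^ k)]) X])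
    \/ powR K (- C) * #|[set: 'Z_(p ^ k)]|%:R <= C * #|A|%:R.
Proof.
(* A single [c] serves as factor and as exponent: it exceeds the exponents 27 and 25, and both
   constants once [2 * L] is replaced by [4 * K]. *)
have [c c27 [cX cR]] : exists2 c, (27 <= c)%N &
    (512 * 4 ^ 27 <= c)%N /\ (256 * 4 ^ 25 <= c)%N.
  have mono a b e f : (a <= b -> e <= f -> a * 4 ^ e <= b * 4 ^ f)%N.
    by move=> ab ef; rewrite leq_mul // leq_exp2l.
  exists (512 * 4 ^ 27)%N.
    by apply: (@leq_trans (27 * 4 ^ 0)); [rewrite muln1 | apply: mono].
  by split; apply: mono.
have C0 : 0 < c%:R :> F by rewrite ltr0n (leq_trans _ c27).
exists c%:R; split=> // p k A K p_pr k0 An0 K1 AA AM.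
have K0 : 0 <= K := le_trans ler01 K1.
(* An integer substitute for [K]; as [1 <= K], rounding up at most doubles it. *)
pose L := (Num.truncn K).+1.
have KL : K <= L%:R := ltW (truncnS_gt K).
have LK : L%:R <= 2 * K.
  by rewrite mulr_natl mulr2n -natr1 lerD // truncn_le.
have natL m : m%:R <= K * #|A|%:R -> (m <= L * #|A|)%N.
  move=> le_m; rewrite -(ler_nat F) natrM; apply: le_trans le_m _.
  by rewrite ler_wpM2r.
have powK (m n e : nat) : (e <= c)%N -> (m * 4 ^ e <= c)%N ->
    (n <= m * (2 * L) ^ e)%N -> n%:R <= c%:R * powR K c%:R.
  move=> ec mc le_n; rewrite powR_mulrn //.
  apply: (@le_trans _ _ ((m * (2 * L) ^ e)%:R)); first by rewrite ler_nat.
  apply: (@le_trans _ _ ((m * 4 ^ e)%:R * K ^+ e)); last first.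
    by apply: ler_pM; rewrite ?exprn_ge0 ?ler_nat // ler_weXn2l.
  rewrite !natrM !natrX -mulrA ler_wpM2l // -exprMn lerXn2r ?nnegrE ?mulr_ge0 //.
  by rewrite natrM -[4]/((2 * 2)%:R) natrM -mulrA ler_wpM2l.
set N := natdilate p [set: 'Z_(p ^ k)].
have N0 : 0 \in N by apply/imsetP; exists 0; rewrite ?inE ?mulr0.
have NB : {in N &, forall x y, x - y \in N}.
  move=> _ _ /imsetP[y _ ->] /imsetP[z _ ->]; rewrite -mulrBr.
  by apply/imsetP; exists (y - z); rewrite ?inE.
have NM r x : x \in N -> r * x \in N.
  by case/imsetP=> y _ ->; apply/imsetP; exists (r * y); rewrite ?inE // mulrCA.
have unitN x : x \notin N -> x \is a GRing.unit by apply: natdilate_Zpk_unit.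
have genR (x : 'Z_(p ^ k)) : exists n, x = n%:R by exists x; rewrite natr_Zp.
have [[X [X0 Xsmall AX]]|large] :=
  sum_product_local An0 (natL _ AA) (natL _ AM) N0 NB NM unitN genR.
  by left; exists X; split=> //; apply: powK Xsmall.
(* Moving the power of [K] to the right reduces the claim to [|R| <= c K^c |A|]. *)
right; rewrite powRN mulrC ler_pdivrMr ?powR_gt0 ?(lt_le_trans ltr01) //.
apply: (@le_trans _ _ ((256 * (2 * L) ^ 25 * #|A|)%:R)); first by rewrite ler_nat.
rewrite natrM mulrAC ler_wpM2r //.
exact: powK (leq_trans _ c27) cR (leqnn _).
Qed.
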